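(* Let $k\geq 2$, let $\mathbb F_q$ be the finite field with $q$ elements, let $\beta\in\mathbb Z_{\geq 0}^k$, and let $V_1,\ldots,V_k$ be vector spaces over $\mathbb F_q$ with $\dim V_i=\beta_i$. For each $\gamma\in\mathcal R(\beta)$, $$|\mathcal N_\gamma(\beta)|=q^{(\beta-\gamma)\cdot\sigma\beta+\gamma_k(\beta_1-1)}\begin{bmatrix}\beta\\ \gamma\end{bmatrix}_q\prod_{i=1}^{k-1}\left(\begin{bmatrix}\gamma_i\\ \gamma_{i+1}\end{bmatrix}_q|\mathrm{GL}_{\gamma_{i+1}}(\mathbb F_q)|\right).$$
   Context: Indices are taken modulo $k$. $Q$ is the cyclic quiver $1\to 2\to\cdots\to k\to 1$ and $\mathrm{Rep}(Q,\beta)=\prod_{i=1}^k\mathrm{Hom}_{\mathbb F_q}(V_i,V_{i+1})$. A representation $f=(f_1,\ldots,f_k)\in\mathrm{Rep}(Q,\beta)$ is nilpotent if for each $1\leq i\leq k$ and all sufficiently large $\ell$ the composition $f_{i+\ell-1}\circ\cdots\circ f_i$ is zero; $\mathcal N(\beta)$ is the set of nilpotent representations. For $f\in\mathrm{Rep}(Q,\beta)$ put $\mathrm{rank}\,f:=(\beta_1,\mathrm{rank}(f_1),\mathrm{rank}(f_2f_1),\ldots,\mathrm{rank}(f_{k-1}\cdots f_1))\in\mathbb Z_{\geq 0}^k$. Let $\mathcal R(\beta):=\{\mathrm{rank}\,f: f\in\mathrm{Rep}(Q,\beta)\}$ and $\mathcal N_\gamma(\beta):=\{f\in\mathcal N(\beta):\mathrm{rank}\,f=\gamma\}$.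 The dot product is $\beta\cdot\gamma=\sum_{i=1}^k\beta_i\gamma_i$, and $\sigma\beta=(\beta_2,\ldots,\beta_k,\beta_1)$. For integers $0\leq r\leq n$, $\begin{bmatrix}n\\ r\end{bmatrix}_q=\frac{(1-q^n)(1-q^{n-1})\cdots(1-q^{n-r+1})}{(1-q^r)\cdots(1-q^2)(1-q)}$ is the $q$-binomial coefficient, and for vectors $\gamma\leq\beta$ (componentwise), $\begin{bmatrix}\beta\\ \gamma\end{bmatrix}_q:=\prod_{i=1}^k\begin{bmatrix}\beta_i\\ \gamma_i\end{bmatrix}_q$. $|\mathrm{GL}_r(\mathbb F_q)|=\prod_{i=0}^{r-1}(q^r-q^i)$ (equal to $1$ for $r=0$). *)

(* Defs.v *)
From mathcomp Require Import all_boot all_order all_algebra all_field.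
From mathcomp Require Import boolp.

Set Implicit Arguments.
Unset Strict Implicit.
Unset Printing Implicit Defensive.

Import GRing.Theory.
Local Open Scope ring_scope.

(* The vertices 1, ..., k of the cyclic quiver are the elements 0, ..., k - 1  *)
(* of 'I_k, and ordS is the cyclic successor.                                  *)

Definition first_vertex k (hk : (1 < k)%N) : 'I_k := Ordinal (ltnW hk).

Definition last_vertex k (hk : (1 < k)%N) : 'I_k := rev_ord (first_vertex hk).

Section CyclicQuiver.

Variables (F : finFieldType) (k : nat) (V : 'I_k -> vectType F).

(* finvect_type T is T itself, with the finType structure coming from the     *)
(* finiteness of F.                                                           *)
Definition Rep : predArgType :=
  {dffun forall i : 'I_k, finvect_type 'Hom(V i, V (ordS i))}.

Definition arrow (f : Rep) (i : 'I_k) : 'Hom(V i, V (ordS i)) := f i.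

(* f_(i+l-1) o ... o f_i, the identity of V_i for l = 0                        *)
Fixpoint path_comp (f : Rep) (i : 'I_k) (l : nat) :
    'Hom(V i, V (iter l (@ordS k) i)) :=
  match l with
  | 0 => \1%VF
  | l'.+1 => (arrow f (iter l' (@ordS k) i) \o path_comp f i l')%VF
  end.

Definition nilpotent_rep (f : Rep) : Prop :=
  forall i : 'I_k, exists L : nat, forall l : nat, (L <= l)%N ->
    path_comp f i l = 0.

(* The entry at 0 is the rank of the identity of the first space, that is,    *)
(* its dimension: see rank_vector_first.                                      *)
Definition rank_vector (hk : (1 < k)%N) (f : Rep) : {ffun 'I_k -> nat} :=
  [ffun j : 'I_k => \dim (limg (path_comp f (first_vertex hk) j))].

Lemma rank_vector_first (hk : (1 < k)%N) (f : Rep) :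
  rank_vector hk f (first_vertex hk) = \dim {: V (first_vertex hk)}.
Proof. by rewrite ffunE /= lim1g. Qed.

Definition is_rank_vector (hk : (1 < k)%N) (gamma : {ffun 'I_k -> nat}) : Prop :=
  exists f : Rep, rank_vector hk f = gamma.

Definition nilpotent_of_rank (hk : (1 < k)%N) (gamma : {ffun 'I_k -> nat}) :
    {set Rep} :=
  [set f : Rep | `[< nilpotent_rep f >] & rank_vector hk f == gamma].

End CyclicQuiver.

Definition qbinom (q : rat) (n r : nat) : rat :=
  (\prod_(i < r) (1 - q ^+ (n - i))) / (\prod_(i < r) (1 - q ^+ i.+1)).

Definition qbinom_vector (q : rat) k (beta gamma : 'I_k -> nat) : rat :=
  \prod_(i < k) qbinom q (beta i) (gamma i).

(* Not #|'GL_r[F]|, which for r = 0 is the group of 1 x 1 matrices.            *)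
Definition GL_order (F : finFieldType) (r : nat) : nat :=
  #|[set A : 'M[F]_r | A \in unitmx]|.

Definition dot k (u v : 'I_k -> int) : int := \sum_(i < k) u i * v i.

Definition shift k T (u : 'I_k -> T) : 'I_k -> T := fun i => u (ordS i).

(* In int, so that beta_1 - 1 is not truncated.                                *)
Definition count_exponent k (hk : (1 < k)%N) (beta gamma : 'I_k -> nat) : int :=
  dot (fun i => (beta i)%:Z - (gamma i)%:Z) (shift (fun i => (beta i)%:Z))
  + (gamma (last_vertex hk))%:Z * ((beta (first_vertex hk))%:Z - 1).

(* Main.v *)
Require Import Defs.
From mathcomp Require Import all_boot all_order all_algebra all_field.
From mathcomp Require Import boolp ring zify.

(* Write [w_l] for the [l]-th vertex after the first one and [P_l] for the
   composition of the first [l] arrows. Given [P_l] of rank [r], an arrow [x]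
   out of [w_l] enters the next rank only through its restriction to the image
   of [P_l]; so the number of [x] with [rank (x P_l) = s] is the number of
   matrices of rank [s] with [r] rows, times a power of [q]. A representation is
   nilpotent iff the loop at the first vertex is, and for [P] of rank [r] the
   product [x P] is nilpotent iff an [r x r] compression of [x], depending
   linearly and surjectively on [x], is. By the Fine-Herstein theorem a matrix is
   nilpotent with probability [q ^ - r], whatever [P] of rank [r] is.

   Fine-Herstein is proved by counting pairs [(A, v)] with [A] nilpotent
   according to the least [d] with [v A ^ d = 0]: the vectors
   [v, v A, ..., v A ^ (d - 1)] are independent, and the nilpotent [A] with a
   given such chain are block triangular, with an arbitrary nilpotent block of
   size [n - d]. *)

Set Implicit Arguments.
Unset Strict Implicit.
Unset Printing Implicit Defensive.

Import Order.TTheory GRing.Theory Num.Theory.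
Local Open Scope ring_scope.

(** * Matrices of given rank *)

(** The fibre of [phi] over [y] is the kernel translated by [s y], so all fibres have the same size.
    Like the counts below, the identity is stated without division. *)
Lemma card_preim_split_additive (A B : finZmodType) (phi : {additive A -> B})
    (s : B -> A) (S : {set B}) : cancel s phi ->
  (#|[set x | phi x \in S]| * #|B| = #|S| * #|A|)%N.
Proof.
move=> sK; have fib (T : {set B}) :
    #|[set x | phi x \in T]| = (#|T| * #|[set x | phi x == 0%R]|)%N.
  rewrite -sum1_card (partition_big phi (mem T)) /=; last by move=> x; rewrite inE.
  rewrite -sum_nat_const; apply: eq_bigr => y yT.
  rewrite sum1_card -[RHS](card_imset _ (addrI (s y))).
  apply: eq_card => x; apply/idP/imsetP => [|[z]]; last first.
    by rewrite inE => /eqP z0 ->; rewrite unfold_in /= inE raddfD /= sK z0 addr0 yT eqxx.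
  rewrite unfold_in /= inE => /andP[_ /eqP phix]; exists (x - s y); last by rewrite addrC subrK.
  by rewrite inE raddfB /= sK phix subrr.
have -> : #|A| = #|[set x | phi x \in [set: B]]|.
  by rewrite -cardsT; apply: eq_card => x; rewrite !inE.
by rewrite !fib cardsT; ring.
Qed.

Section MatrixCounting.

Variable F : finFieldType.
Local Notation q := #|F|.

Lemma card_vectors_in_rowspace m n (B : 'M[F]_(m, n)) :
  #|[set u : 'rV_n | (u <= B)%MS]| = (q ^ \rank B)%N.
Proof.
have inj : injective (mulmx^~ (row_base B) : 'rV_(\rank B) -> 'rV_n).
  exact: row_free_inj (row_base_free B).
rewrite -[in RHS](mul1n (\rank B)) -card_mx -cardsT -(card_imset _ inj).
apply: eq_card => u; rewrite inE -(eq_row_base B).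
by apply/submxP/imsetP => [[w ->]|[w _ ->]]; exists w.
Qed.

Lemma row_free_col_mx m n (u : 'rV[F]_n) (B : 'M_(m, n)) :
  row_free (col_mx u B) = row_free B && ~~ (u <= B)%MS.
Proof.
rewrite /row_free -addsmxE; have [uB|nuB] := boolP (u <= B)%MS.
  by rewrite andbF (addsmx_idPr uB) ltn_eqF // ltnS rank_leq_row.
rewrite andbT; have ltB : (\rank B < \rank (u + B)%MS)%N.
  by rewrite rank_ltmx // ltmxE addsmxSr addsmx_sub negb_and nuB.
have := mxrank_adds_leqif u B; have := rank_leq_row u; have := rank_leq_row B.
by move: ltB => + + + [+ _]; lia.
Qed.

(** Rows are added one at a time: over a free [B] with [m] rows, the new row must avoid the [q ^ m]
    vectors of its row space. If [m > n], the factor at [i = n] vanishes. *)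
Lemma card_row_free m n :
  #|[set B : 'M[F]_(m, n) | row_free B]| = (\prod_(i < m) (q ^ n - q ^ i))%N.
Proof.
elim: m => [|m IH].
  rewrite big_ord0 -[RHS](_ : #|[set: 'M[F]_(0, n)]| = 1%N); last by rewrite cardsT card_mx.
  by apply: eq_card => B; rewrite !inE flatmx0 /row_free mxrank0.
rewrite big_ord_recr -IH /= -sum_nat_const.
pose g (B : 'M[F]_(1 + m, n)) := dsubmx B.
rewrite -sum1_card (partition_big g (mem [set B : 'M[F]_(m, n) | row_free B])) /=; last first.
  by move=> B; rewrite !inE -{1}[B]vsubmxK row_free_col_mx => /andP[].
apply: eq_bigr => B; rewrite inE => freeB; rewrite sum1_card.
have inj : injective (fun u : 'rV_n => col_mx u B : 'M[F]_(m.+1, n)).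
  by move=> u v /(@eq_col_mx _ 1) [].
have -> : (q ^ n - q ^ m = #|~: [set u : 'rV[F]_n | (u <= B)%MS]|)%N.
  by rewrite cardsCs setCK card_vectors_in_rowspace (eqP freeB) card_mx mul1n.
rewrite -(card_imset _ inj); apply: eq_card => C; rewrite unfold_in /= inE.
apply/andP/imsetP => [[freeC /eqP <-]|[u]].
  exists (usubmx (C : 'M_(1 + m, n))); last by rewrite vsubmxK.
  by move: freeC; rewrite !inE -{1}[C](@vsubmxK _ 1) row_free_col_mx => /andP[].
by rewrite !inE => uB ->; rewrite row_free_col_mx freeB uB /g col_mxKd.
Qed.

(** Such an [N] is [X *m Y] for a unique [X], and it fills the row space of [Y] exactly when [X] has
    rank [s]. *)
Lemma card_eq_rowspace r s n (Y : 'M[F]_(s, n)) : row_free Y ->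
  #|[set N : 'M[F]_(r, n) | (N == Y)%MS]| = #|[set X : 'M[F]_(r, s) | row_full X]|.
Proof.
move=> freeY; rewrite -(card_imset _ (row_free_inj freeY)).
apply: eq_card => N; rewrite inE; apply/idP/imsetP => [eqNY|[X]].
  have /submxP[X defN] : (N <= Y)%MS by case/andP: eqNY.
  exists X => //; rewrite inE -col_leq_rank -(mxrankMfree X freeY) -defN.
  by rewrite (eqmx_rank eqNY) (eqP freeY).
rewrite inE => fullX ->; apply/eqmxP; exact: eqmxMfull.
Qed.

Lemma card_row_full m n :
  #|[set B : 'M[F]_(m, n) | row_full B]| = #|[set B : 'M[F]_(n, m) | row_free B]|.
Proof.
rewrite -(card_imset _ (@trmx_inj F m n)); apply: eq_card => B.
rewrite inE; apply/imsetP/idP => [[C + ->]|freeB].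
  by rewrite inE /row_free mxrank_tr.
by exists B^T; rewrite ?trmxK // inE /row_full mxrank_tr.
Qed.

Lemma GL_order_row_free n : GL_order F n = #|[set B : 'M[F]_n | row_free B]|.
Proof. by apply: eq_card => B; rewrite !inE row_free_unit. Qed.

(** Double count of the pairs [(N, Y)] where the rows of [Y] form a basis of the row space of [N]:
    the bases for one [N], and the matrices [N] for one [Y], are both counted by
    [card_eq_rowspace]. *)
Lemma card_rank_GL_order r n s :
  (#|[set N : 'M[F]_(r, n) | \rank N == s]| * GL_order F s =
   #|[set X : 'M[F]_(s, r) | row_free X]| * #|[set Y : 'M[F]_(s, n) | row_free Y]|)%N.
Proof.
rewrite -card_row_full [RHS]mulnC -!sum_nat_const.
have -> : (\sum_(N in [set N : 'M[F]_(r, n) | \rank N == s]) GL_order F s =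
   \sum_(N in [set N : 'M[F]_(r, n) | \rank N == s])
     #|[set Y : 'M[F]_(s, n) | row_free Y && (N == Y)%MS]|)%N.
  apply: eq_bigr => N; rewrite inE => /eqP rkN.
  rewrite GL_order_row_free -card_row_full.
  subst s; rewrite -(card_eq_rowspace (\rank N) (row_base_free N)).
  apply: eq_card => Y; rewrite !inE !(eq_row_base N).
  apply/idP/idP => [eqYN|/and3P[_ -> ->] //].
  by rewrite /row_free (eqmx_rank eqYN) eqxx; case/andP: eqYN => -> ->.
under eq_bigr do rewrite -sum1_card.
under [RHS]eq_bigr => Y freeY.
  rewrite -(card_eq_rowspace r (_ : row_free Y)); last by move: freeY; rewrite inE.
  rewrite -sum1_card; over.
rewrite (exchange_big_dep (mem [set Y : 'M[F]_(s, n) | row_free Y])) /=; last first.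
  by move=> N Y _; rewrite !inE => /andP[].
apply: eq_bigr => Y; rewrite inE => freeY; apply: eq_bigl => N.
rewrite !inE freeY /= andb_idl // => /eqmx_rank ->; exact: freeY.
Qed.

End MatrixCounting.

(** * Nilpotent matrices *)

Section NilpotentMatrices.

Variable F : fieldType.

(** Testing the exponent [n] alone gives a boolean; [nilpotent_mxP] shows that this suffices. *)
Definition nilpotent_mx n (A : 'M[F]_n) := A ^+ n == 0.

Definition krylov_mx d n (A : 'M[F]_n) (v : 'rV[F]_n) : 'M_(d, n) :=
  \matrix_(i < d) (v *m A ^+ i).

(** The nilpotent Jordan block: as a left factor it moves every row up by one and makes the last row
    zero. *)
Definition shift_mx d : 'M[F]_d := \matrix_(i, j) (j == i.+1 :> nat)%:R.

Lemma exp_shift_mx d l : shift_mx d ^+ l = \matrix_(i, j) (j == (i + l)%N :> nat)%:R.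
Proof.
elim: l => [|l IH]; first by apply/matrixP => i j; rewrite expr0 !mxE addn0 eq_sym.
apply/matrixP => i j; rewrite exprS IH !mxE.
have [lt_id|le_di] := ltnP i.+1 d.
  rewrite (bigD1 (Ordinal lt_id)) //= !mxE eqxx mul1r addnS addSn big1 ?addr0 //.
  by move=> k nk; rewrite !mxE -val_eqE /= in nk *; rewrite (negPf nk) mul0r.
rewrite big1 => [|k _]; last by rewrite !mxE [_ == _]ltn_eqF ?mul0r // (leq_trans (ltn_ord k)).
by rewrite [_ == _]ltn_eqF // (leq_trans (ltn_ord j)) // addnS -addSn (leq_trans le_di) ?leq_addr.
Qed.

Lemma krylov_mx_mul d n (A : 'M[F]_n) (v : 'rV_n) :
  v *m A ^+ d = 0 -> krylov_mx d A v *m A = shift_mx d *m krylov_mx d A v.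
Proof.
move=> vd0; apply/row_matrixP => i; rewrite !row_mul rowK -mulmxA mulmxE -exprSr.
have [lt_id|le_di] := ltnP i.+1 d.
  rewrite (_ : row i _ = delta_mx 0 (Ordinal lt_id)) -?rowE ?rowK //.
  by apply/rowP => j; rewrite !mxE -val_eqE.
have -> : row i (shift_mx d) = 0.
  by apply/rowP => j; rewrite !mxE ltn_eqF // (leq_trans (ltn_ord j)).
by rewrite mul0mx (_ : i.+1 = d) //; have := ltn_ord i; lia.
Qed.

Lemma row_free_krylov_mx d n (A : 'M[F]_n) (v : 'rV_n) :
    (forall i, (i < d)%N -> v *m A ^+ i != 0) -> v *m A ^+ d = 0 ->
  row_free (krylov_mx d A v).
Proof.
move=> nz vd0; have z l : (d <= l)%N -> v *m A ^+ l = 0.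
  by move=> /subnKC <-; rewrite exprD -mulmxE mulmxA vd0 mul0mx.
apply: inj_row_free => c cK; apply/rowP => i; rewrite mxE.
have [m] := ubnP (i : nat); elim: m i => // m IH i lt_im.
(* The terms [j < i] vanish by induction and this power of [A] kills the rows [j > i], so only [c i]
   times the nonzero vector [v *m A ^+ d.-1] survives. *)
have: c *m krylov_mx d A v *m A ^+ (d.-1 - i) = 0 by rewrite cK mul0mx.
rewrite (mulmx_sum_row c) mulmx_suml (bigD1 i) //= big1 => [|j nji].
  rewrite addr0 rowK -scalemxAl -mulmxA mulmxE -exprD => /eqP.
  rewrite scalemx_eq0 => /orP[/eqP //|]; have := ltn_ord i => lt_id.
  by rewrite (negPf (nz _ _)) //; lia.
rewrite rowK -scalemxAl -mulmxA mulmxE -exprD.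
have [lt_ji|le_ij] := ltnP j i; first by rewrite IH ?scale0r //; lia.
rewrite z ?scaler0 //; move: nji; rewrite -val_eqE /=; have := ltn_ord i.
by lia.
Qed.

(** For the least [d] the chain consists of [d] independent vectors in dimension [n], whence
    [d <= n]. *)
Lemma krylov_order n (A : 'M[F]_n) (v : 'rV_n) l : v *m A ^+ l = 0 ->
  exists d, [/\ (d <= n)%N, v *m A ^+ d = 0 & forall i, (i < d)%N -> v *m A ^+ i != 0].
Proof.
move=> vl0; have ex : exists l, v *m A ^+ l == 0 by exists l; exact/eqP.
have [d /eqP vd0 min_d] := ex_minnP ex; exists d.
have nz i : (i < d)%N -> v *m A ^+ i != 0.
  by move=> lt_id; apply/negP => /min_d; rewrite leqNgt lt_id.
split=> //; have /eqP <- := row_free_krylov_mx nz vd0; exact: rank_leq_col.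
Qed.

Lemma nilpotent_mxP n (A : 'M[F]_n) : reflect (exists l, A ^+ l = 0) (nilpotent_mx A).
Proof.
apply: (iffP eqP) => [An0|[l Al0]]; first by exists n.
apply/row_matrixP => i; rewrite row0 rowE.
have [|d [le_dn vd0 _]] := @krylov_order n A (delta_mx 0 i) l; first by rewrite Al0 mulmx0.
have -> : A ^+ n = A ^+ d *m A ^+ (n - d) by rewrite mulmxE -exprD subnKC.
by rewrite mulmxA vd0 mul0mx.
Qed.

(** Because [(BA)^(l+1) = B (AB)^l A]. As the factors may be rectangular, this reduces nilpotency to
    a smaller matrix. *)
Lemma nilpotent_mx_mulC m n (A : 'M[F]_(m, n)) (B : 'M_(n, m)) :
  nilpotent_mx (A *m B) = nilpotent_mx (B *m A).
Proof.
suff imp m' n' (A' : 'M[F]_(m', n')) (B' : 'M_(n', m')) :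
    nilpotent_mx (A' *m B') -> nilpotent_mx (B' *m A').
  by apply/idP/idP; apply: imp.
move=> /nilpotent_mxP[l ABl0]; apply/nilpotent_mxP; exists l.+1.
suff -> : (B' *m A') ^+ l.+1 = B' *m (A' *m B') ^+ l *m A' by rewrite ABl0 mulmx0 mul0mx.
elim: (l) => [|p IH]; first by rewrite expr1 expr0 mulmx1.
by rewrite exprS IH [in RHS]exprS -!mulmxE !mulmxA.
Qed.

Lemma nilpotent_mx_conj n (P A : 'M[F]_n) : P \in unitmx ->
  nilpotent_mx (P *m A *m invmx P) = nilpotent_mx A.
Proof. by move=> uP; rewrite nilpotent_mx_mulC mulmxA mulVmx // mul1mx. Qed.

Lemma exp_block_lower m n (A : 'M[F]_m) (C : 'M_(n, m)) (D : 'M_n) l :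
  exists C', block_mx A 0 C D ^+ l = block_mx (A ^+ l) 0 C' (D ^+ l).
Proof.
elim: l => [|l [C' IH]]; first by exists 0; rewrite !expr0 -scalar_mx_block.
exists (C *m A ^+ l + D *m C').
by rewrite !exprS IH -mulmxE mulmx_block !mul0mx !mulmx0 !addr0 add0r.
Qed.

Lemma nilpotent_block_lower m n (A : 'M[F]_m) (C : 'M_(n, m)) (D : 'M_n) :
  nilpotent_mx (block_mx A 0 C D) = nilpotent_mx A && nilpotent_mx D.
Proof.
apply/nilpotent_mxP/andP => [[l]|[/nilpotent_mxP[a Aa0] /nilpotent_mxP[d Dd0]]].
  have [C' ->] := exp_block_lower A C D l; rewrite -block_mx0.
  by case/eq_block_mx => Al0 _ _ Dl0; split; apply/nilpotent_mxP; exists l.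
(* The power [a + d] leaves only the lower left block, and such a matrix squares to zero. *)
exists ((a + d) * 2)%N; rewrite exprM; have [C' ->] := exp_block_lower A C D (a + d).
rewrite !exprD Aa0 Dd0 mul0r mulr0 expr2 -mulmxE mulmx_block.
by rewrite !mul0mx !mulmx0 !addr0 block_mx0.
Qed.

Lemma nilpotent_shift_mx d : nilpotent_mx (shift_mx d).
Proof.
apply/eqP/matrixP => i j; rewrite exp_shift_mx !mxE ltn_eqF //.
by rewrite (leq_trans (ltn_ord j)) // leq_addl.
Qed.

End NilpotentMatrices.

(** * The number of nilpotent matrices over a finite field *)

Section FineHerstein.

Variable F : finFieldType.
Local Notation q := #|F|.

Definition nilpotent_count n := #|[set A : 'M[F]_n | nilpotent_mx A]|.

Lemma row_free_completion d m (B : 'M[F]_(d, d + m)) : row_free B ->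
  exists C : 'M_(m, d + m), col_mx B C \in unitmx.
Proof.
move=> /eqP rB; exists (dsubmx (row_ebase B)).
have defB : B = col_ebase B *m usubmx (row_ebase B).
  rewrite -{1}[B]mulmx_ebase rB -[in LHS](vsubmxK (row_ebase B)).
  have -> : pid_mx d = row_mx 1%:M 0 :> 'M[F]_(d, d + m) by rewrite pid_mx_row.
  by rewrite -mulmxA mul_row_col mul1mx mul0mx addr0.
have -> : col_mx B (dsubmx (row_ebase B)) =
    block_mx (col_ebase B) 0 0 1%:M *m row_ebase B.
  rewrite -[in RHS](vsubmxK (row_ebase B)) mul_block_col !mul0mx addr0 add0r mul1mx.
  by rewrite -defB.
rewrite unitmx_mul row_ebase_unit andbT unitmxE det_ublock det1 mulr1 -unitmxE.
exact: col_ebase_unit.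
Qed.

(** In a basis [P] extending [B], the condition on [B] forces the upper blocks of [A] to be the
    shift and [0]. The lower left block is then free, and the lower right one is any nilpotent
    matrix. *)
Lemma card_nilpotent_extending_add d m (B : 'M[F]_(d, d + m)) : row_free B ->
  #|[set A : 'M_(d + m) | nilpotent_mx A && (B *m A == shift_mx F d *m B)]| =
    (q ^ (m * d) * nilpotent_count m)%N.
Proof.
move=> /row_free_completion[C uP]; set P := col_mx B C in uP.
pose f (XY : 'M[F]_(m, d) * 'M[F]_m) :=
  invmx P *m block_mx (shift_mx F d) 0 XY.1 XY.2 *m P.
have injf : injective f.
  move=> [X Y] [X' Y'] eqf.
  have : P *m f (X, Y) *m invmx P = P *m f (X', Y') *m invmx P by rewrite eqf.
  by rewrite /f /= -!mulmxA !(mulmxV uP) !mulmx1 !mulKVmx // => /eq_block_mx[_ _ -> ->].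
have -> : (q ^ (m * d) * nilpotent_count m)%N =
    #|setX [set: 'M[F]_(m, d)] [set A : 'M[F]_m | nilpotent_mx A]|.
  by rewrite cardsX cardsT card_mx.
rewrite -[RHS](card_imset _ injf); apply: eq_card => A; rewrite inE.
apply/andP/imsetP => [[nilA /eqP BA]|[[X Y]]]; last first.
  rewrite !inE /= => nilY ->; split.
    by rewrite /f nilpotent_mx_mulC mulKVmx // nilpotent_block_lower nilpotent_shift_mx.
  have : P *m f (X, Y) = block_mx (shift_mx F d) 0 X Y *m P by rewrite /f -mulmxA mulKVmx.
  by rewrite /P mul_col_mx mul_block_col mul0mx addr0 => /eq_col_mx[-> _].
pose A' := P *m A *m invmx P.
have defA' : A' = block_mx (shift_mx F d) 0 (dlsubmx A') (drsubmx A').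
  (* This is the upper block row of [A' *m P = P *m A], from which the free matrix [P] is
     cancelled. *)
  suff eqP : row_mx (ulsubmx A' - shift_mx F d) (ursubmx A') = 0.
    rewrite -[LHS]submxK; move: eqP; rewrite -row_mx0 => /eq_row_mx[/subr0_eq -> ->].
    by [].
  apply: (row_free_inj (_ : row_free P)); first by rewrite row_free_unit.
  rewrite mul0mx mul_row_col mulmxBl -BA.
  have : A' *m P = P *m A by rewrite mulmxKV.
  rewrite -[A' in A' *m P]submxK {1 2}/P mul_block_col mul_col_mx => /eq_col_mx[<- _].
  by rewrite addrAC subrr.
exists (dlsubmx A', drsubmx A'); last by rewrite /f /= -defA' /A' -!mulmxA mulVmx // mulmx1 mulKmx.
rewrite !inE /=; have : nilpotent_mx A' by rewrite nilpotent_mx_conj.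
by rewrite defA' nilpotent_block_lower block_mxKdr => /andP[].
Qed.

Lemma card_nilpotent_extending d n (B : 'M[F]_(d, n)) : row_free B ->
  #|[set A : 'M_n | nilpotent_mx A && (B *m A == shift_mx F d *m B)]| =
    (q ^ ((n - d) * d) * nilpotent_count (n - d))%N.
Proof.
move=> freeB; have le_dn : (d <= n)%N by rewrite -(eqP freeB) rank_leq_col.
have [m defn] : exists m, n = (d + m)%N by exists (n - d)%N; rewrite subnKC.
by subst n; rewrite card_nilpotent_extending_add // addKn.
Qed.

Definition krylov_order_at n d (p : 'M[F]_n * 'rV[F]_n) :=
  [&& nilpotent_mx p.1, p.2 *m p.1 ^+ d == 0 & [forall i : 'I_d, p.2 *m p.1 ^+ i != 0]].

(** Thus [A] and the first row of [B] determine [B]; the size [d.+1] guarantees that there is a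
    first row. *)
Lemma krylov_chain d n (A : 'M[F]_n) (B : 'M_(d.+1, n)) :
    B *m A = shift_mx F d.+1 *m B ->
  B = krylov_mx d.+1 A (row 0 B) /\ row 0 B *m A ^+ d.+1 = 0.
Proof.
move=> BA; have BAl l : B *m A ^+ l = shift_mx F d.+1 ^+ l *m B.
  elim: l => [|l IH]; first by rewrite !expr0 mulmx1 mul1mx.
  by rewrite exprSr -mulmxE mulmxA IH -mulmxA BA mulmxA mulmxE -exprSr.
split; last by rewrite -row_mul BAl (eqP (nilpotent_shift_mx F d.+1)) mul0mx row0.
apply/row_matrixP => i; rewrite rowK -row_mul BAl row_mul rowE; congr (_ *m _).
by apply/rowP => j; rewrite exp_shift_mx !mxE -val_eqE /= add0n.
Qed.

(** Sending [v] to its Krylov chain [B] identifies these pairs [(A, v)] with the pairs [(B, A)]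
    where [B] is free and the nilpotent [A] acts on it as the shift; these are counted over each
    [B]. *)
Lemma card_krylov_order_at n d :
  #|[set p | @krylov_order_at n d.+1 p]| =
   (#|[set B : 'M[F]_(d.+1, n) | row_free B]| *
     (q ^ ((n - d.+1) * d.+1) * nilpotent_count (n - d.+1)))%N.
Proof.
pose T := [set p : 'M[F]_(d.+1, n) * 'M[F]_n | row_free p.1 &&
  (nilpotent_mx p.2 && (p.1 *m p.2 == shift_mx F d.+1 *m p.1))].
pose g (p : 'M[F]_(d.+1, n) * 'M[F]_n) := (p.2, row 0 p.1).
have injg : {in T &, injective g}.
  move=> [B A] [B' A']; rewrite !inE /= => /and3P[_ _ /eqP BA] /and3P[_ _ /eqP BA'].
  move=> [eqA eqB]; rewrite (krylov_chain BA).1 (krylov_chain BA').1 eqA eqB.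
  by [].
transitivity #|T|.
  rewrite -(card_in_imset injg); apply: eq_card => -[A v]; rewrite inE.
  apply/and3P/imsetP => /= [[nilA /eqP vd0 /forallP nz]|[[B A']]].
    have freeK : row_free (krylov_mx d.+1 A v).
      by apply: row_free_krylov_mx => // i lt_id; apply: (nz (Ordinal lt_id)).
    exists (krylov_mx d.+1 A v, A); first by rewrite inE /= freeK nilA krylov_mx_mul /=.
    by rewrite /g /= rowK expr0 mulmx1.
  rewrite inE /= => /and3P[freeB nilA /eqP BA] [-> ->].
  have [defB ->] := krylov_chain BA; split=> //; apply/forallP => i.
  have -> : row 0 B *m A' ^+ i = row i B by rewrite {2}defB rowK.
  apply: contraL freeB => /eqP Bi0; apply: contraTN isT => freeB.
  have /(row_free_inj freeB)/rowP/(_ i) : delta_mx 0 i *m B = 0 *m B :> 'rV_n.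
    by rewrite -rowE Bi0 mul0mx.
  by rewrite !mxE !eqxx => /eqP; rewrite oner_eq0.
rewrite -sum_nat_const.
rewrite -sum1_card (partition_big fst (mem [set B : 'M[F]_(d.+1, n) | row_free B])) /=; last first.
  by move=> [B A]; rewrite !inE => /andP[].
apply: eq_bigr => B; rewrite inE => freeB; rewrite sum1_card -(card_nilpotent_extending freeB).
have inj : injective (fun A : 'M[F]_n => (B, A)) by move=> A A' [].
rewrite -[RHS](card_imset _ inj); apply: eq_card => -[B' A]; rewrite unfold_in /= inE /=.
apply/andP/imsetP => [[/andP[_ nilA] /eqP defB]|[A' nilA [-> ->]]].
  by subst B'; exists A; rewrite ?inE.
by rewrite freeB; move: nilA; rewrite inE.
Qed.

Lemma krylov_order_at_inj n d d' p :
  @krylov_order_at n d p -> krylov_order_at d' p -> d = d'.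
Proof.
move=> /and3P[_ d0 /forallP nz] /and3P[_ d'0 /forallP nz'].
case: (ltngtP d d') => // lt.
  by have := nz' (Ordinal lt); rewrite d0.
by have := nz (Ordinal lt); rewrite d'0.
Qed.

Lemma card_nilpotent_pairs n :
  (nilpotent_count n * q ^ n = \sum_(d < n.+1) #|[set p | @krylov_order_at n d p]|)%N.
Proof.
have -> : (nilpotent_count n * q ^ n =
    #|setX [set A : 'M[F]_n | nilpotent_mx A] [set: 'rV[F]_n]|)%N.
  by rewrite cardsX cardsT card_mx mul1n.
(* The default [0] is never reached on the pairs counted: for nilpotent [A], [krylov_order] gives an
   order at most [n]. *)
pose ord (p : 'M[F]_n * 'rV[F]_n) : 'I_n.+1 :=
  odflt 0 [pick d : 'I_n.+1 | krylov_order_at d p].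
rewrite -sum1_card (partition_big ord predT) //=; apply: eq_bigr => d _.
rewrite sum1_card; apply: eq_card => -[A v]; rewrite unfold_in /= !inE andbT.
apply/andP/idP => [[/= nilA /eqP <-]|ordd].
  rewrite /ord; case: pickP => [//|no]; have [l Al0] := nilpotent_mxP _ nilA.
  have [|d' [le_d'n vd'0 nz]] := @krylov_order _ _ A v l; first by rewrite Al0 mulmx0.
  have /negP[] := no (inord d'); apply/and3P; rewrite inordK //; split=> //=; first exact/eqP.
  by apply/forallP => i; apply: nz.
split; first by case/and3P: ordd.
rewrite /ord; case: pickP => [d' ordd'|/(_ d)]; last by rewrite ordd.
by apply/eqP/val_inj; apply: krylov_order_at_inj ordd' ordd.
Qed.

Lemma card_krylov_order_at0 n : #|[set p | @krylov_order_at n 0 p]| = nilpotent_count n.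
Proof.
have inj : injective (fun A : 'M[F]_n => (A, 0 : 'rV[F]_n)) by move=> A A' [].
rewrite -[RHS](card_imset _ inj); apply: eq_card => -[A v]; rewrite inE.
apply/and3P/imsetP => [[/= nilA]|[A' + [-> ->]]].
  by rewrite expr0 mulmx1 => /eqP -> _; exists A; rewrite ?inE.
by rewrite inE /= mul0mx eqxx => ->; split=> //; apply/forallP => -[].
Qed.

(* Multiplied by [q ^ n], the summand of [card_nilpotent_pairs] for [d > 0] is
   [T d - T d.+1] with [T] as below. *)
Lemma card_nilpotent_mx n : (nilpotent_count n * q ^ n = q ^ (n * n))%N.
Proof.
have [m] := ubnP n; elim: m n => // m IH n lt_nm.
have q1 : (1 < q)%N by exact: finRing_gt1.
case: (posnP n) => [->|n_gt0].
  rewrite muln1 -[RHS](_ : #|[set: 'M[F]_0]| = 1%N); last by rewrite cardsT card_mx.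
  by apply: eq_card => A; rewrite !inE /nilpotent_mx expr0 [1]flatmx0 eqxx.
pose I d := (\prod_(i < d) (q ^ n - q ^ i))%N.
pose T d : int := ((I d)%:Z * (q ^ ((n.+1 - d) * n))%:Z).
have step (d : 'I_n) :
    (#|[set p | @krylov_order_at n d.+1 p]| * q ^ n)%N%:Z = T d.+1 - T d.+2.
  have lt_dn := ltn_ord d.
  rewrite card_krylov_order_at card_row_free -/(I d.+1).
  set r := (n - d.+1)%N; have defn : n = (r + d.+1)%N by rewrite /r subnK.
  have -> : (q ^ n = q ^ r * q ^ d.+1)%N by rewrite {1}defn expnD.
  have := IH r; rewrite /r => /(_ ltac:(lia)); rewrite -/r => IHr.
  transitivity (((I d.+1) * (q ^ (r * d.+1) * (nilpotent_count r * q ^ r) * q ^ d.+1))%N%:Z).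
    by congr Posz; ring.
  rewrite IHr -!expnD /T.
  have -> : (n.+1 - d.+1 = r.+1)%N by rewrite /r; lia.
  have -> : (n.+1 - d.+2 = r)%N by rewrite /r; lia.
  have -> : I d.+2 = (I d.+1 * (q ^ n - q ^ d.+1))%N by rewrite /I big_ord_recr.
  have -> : (r * d.+1 + r * r + d.+1 = d.+1 + r * n)%N by have := congr1 (muln r) defn; nia.
  by rewrite mulSn !expnD !PoszM -subzn ?leq_exp2l //; ring.
have := card_nilpotent_pairs n; rewrite big_ord_recl card_krylov_order_at0 => eqn.
have sumT : \sum_(d < n) (T d.+1 - T d.+2) = T 1%N - T n.+1.
  rewrite -(big_mkord xpredT (fun d => T d.+1 - T d.+2)).
  by rewrite (telescope_sumr_eq (fun d => - T d.+1)) // => [|d _]; ring.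
have T1 : T 1%N = ((q ^ n)%:Z - 1) * (q ^ (n * n))%:Z.
  by rewrite /T /I big_ord1 expn0 subSS subn0 -subzn // expn_gt0 (ltnW q1).
have Tn : T n.+1 = 0 by rewrite /T /I big_ord_recr /= subnn muln0 mul0r.
(* This needs [n > 0], hence the separate case [n = 0]. *)
have qn1 : (q ^ n)%:Z - 1 != 0 :> int by rewrite subr_eq0 eqz_nat -(expn0 q) eqn_exp2l // -lt0n.
(* Order zero contributes the first term and the other orders telescope; the result is the claim
   multiplied by [q ^ n - 1]. *)
have eqnz : (nilpotent_count n * q ^ n * q ^ n)%N%:Z =
    (nilpotent_count n * q ^ n)%N%:Z + (T 1%N - T n.+1).
  rewrite {1}eqn mulnDl PoszD -sumT big_distrl /=; congr (_ + _).
  by rewrite (big_morph Posz PoszD (erefl _)); apply: eq_bigr => d _; rewrite step.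
apply/eqP; rewrite -eqz_nat; apply/eqP/(mulfI qn1).
rewrite -T1 mulrBl mul1r -PoszM [X in X%:Z - _]mulnC eqnz Tn; ring.
Qed.

End FineHerstein.

(** * Linear maps composed with a fixed one *)

Import VectorInternalTheory.

Section RelativeCounting.

Variable F : finFieldType.
Local Notation q := #|F|.

(** Removing the full factor [col_base P] keeps the rank, and multiplication by the free
    [row_base P] is a split surjection. *)
Lemma card_rank_mulmx a b c s (P : 'M[F]_(a, b)) :
  (#|[set M : 'M[F]_(b, c) | \rank (P *m M) == s]| * q ^ (\rank P * c) =
   #|[set N : 'M[F]_(\rank P, c) | \rank N == s]| * q ^ (b * c))%N.
Proof.
pose phi : {additive 'M[F]_(b, c) -> 'M_(\rank P, c)} := mulmx (row_base P).
have phiK : cancel (mulmx (pinvmx (row_base P))) phi.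
  by move=> N; rewrite /phi /= mulmxA mulmxVp ?row_base_free // mul1mx.
rewrite -!card_mx.
have := card_preim_split_additive [set N : 'M[F]_(\rank P, c) | \rank N == s] phiK.
move=> <-; congr (_ * _)%N; apply: eq_card => M; rewrite !inE.
by rewrite -[P in LHS]mulmx_base -mulmxA (eqmxMfull _ (col_base_full P)).
Qed.

(** Write [P = C R] with [C] and [R] of full rank [r]. Then [C R M] is nilpotent iff the [r x r]
    matrix [R M C] is, and [M] maps onto all such matrices with equal fibres. *)
Lemma card_nilpotent_mulmx a b (P : 'M[F]_(a, b)) :
  (#|[set M : 'M[F]_(b, a) | nilpotent_mx (P *m M)]| * q ^ \rank P = q ^ (b * a))%N.
Proof.
set r := \rank P.
pose phi : {additive 'M[F]_(b, a) -> 'M[F]_r} := mulmxr (col_base P) \o mulmx (row_base P).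
have [R RK] := row_freeP (row_base_free P); have [C CK] := row_fullP (col_base_full P).
have phiK : cancel (fun N => R *m N *m C) phi.
  by move=> N; rewrite /phi /= -(mulmxA R) (mulmxA _ R) RK mul1mx -mulmxA CK mulmx1.
have := card_preim_split_additive [set N : 'M[F]_r | nilpotent_mx N] phiK.
have -> : [set M | phi M \in [set N : 'M[F]_r | nilpotent_mx N]] =
    [set M : 'M[F]_(b, a) | nilpotent_mx (P *m M)].
  apply/setP => M; rewrite !inE /phi /= -[P in RHS]mulmx_base -[in RHS]mulmxA.
  by rewrite [RHS]nilpotent_mx_mulC.
rewrite !card_mx => eq1; have eq2 := card_nilpotent_mx F r.
have : (0 < q ^ (r * r))%N by rewrite expn_gt0 (ltnW (finRing_gt1 _)).
by move/eqn_pmul2r=> cancel_pos; apply/eqP; rewrite -cancel_pos mulnAC eq1 mulnAC eq2 mulnC.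
Qed.

End RelativeCounting.

(** * Transfer of the matrix counts to linear maps *)

Section LinearMaps.

Variable F : fieldType.
Implicit Types U V W : vectType F.

(** Matrices act on row vectors, which reverses the order of the factors. *)
Lemma f2mx_comp U V W (g : 'Hom(V, W)) (f : 'Hom(U, V)) :
  f2mx (g \o f)%VF = f2mx f *m f2mx g.
Proof.
apply/row_matrixP => i; rewrite !rowE mulmxA.
by rewrite /comp_lfun unlock /= mul_rV_lin1 /= !unlock /= !r2vK.
Qed.

Lemma dim_limg U V (f : 'Hom(U, V)) : \dim (limg f) = \rank (f2mx f).
Proof.
by rewrite /dimv /lfun_img locked_withE mx2vsK /= genmx1 mul1mx.
Qed.

Lemma iter_nilpotent_mx U (h : 'End(U)) :
  (exists m, forall u, iter m h u = 0) <-> nilpotent_mx (f2mx h).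
Proof.
have it m u : iter m h u = r2v (v2r u *m f2mx h ^+ m).
  elim: m => [|m IH]; first by rewrite expr0 mulmx1 v2rK.
  by rewrite iterS IH exprSr -mulmxE mulmxA unlock /= r2vK.
split=> [[m hm0]|/nilpotent_mxP[m hm0]]; last by exists m => u; rewrite it hm0 mulmx0 linear0.
apply/nilpotent_mxP; exists m; apply/row_matrixP => i; rewrite rowE row0.
by apply: r2v_inj; rewrite linear0 -(hm0 (r2v (delta_mx 0 i))) it r2vK.
Qed.

End LinearMaps.

Section CountingLinearMaps.

Variable F : finFieldType.
Implicit Types U V W : vectType F.
Local Notation q := #|F|.

Lemma card_hom_preim V W (S : {set 'M[F]_(dim V, dim W)}) :
  #|[set M : finvect_type 'Hom(V, W) | f2mx (M : 'Hom(V, W)) \in S]| = #|S|.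
Proof.
have inj : injective (fun A : 'M[F]_(dim V, dim W) => Hom A : finvect_type 'Hom(V, W)).
  by move=> A A' [].
rewrite -[RHS](card_imset _ inj); apply: eq_card => -[M]; rewrite inE /=.
by apply/idP/imsetP => [SM|[M' ? [->]]] //; exists M.
Qed.

Lemma card_hom V W : #|{: finvect_type 'Hom(V, W)}| = (q ^ (\dim {:V} * \dim {:W}))%N.
Proof.
rewrite !dimvf -card_mx -cardsT -[RHS]cardsT -card_hom_preim.
by apply: eq_card => M; rewrite !inE.
Qed.

Lemma card_hom_rank U V W (P : 'Hom(U, V)) s :
  (#|[set M : finvect_type 'Hom(V, W) | \dim (limg ((M : 'Hom(V, W)) \o P)%VF) == s]|
     * q ^ (\dim (limg P) * \dim {:W}) =
   #|[set N : 'M[F]_(\dim (limg P), \dim {:W}) | \rank N == s]|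
     * #|{: finvect_type 'Hom(V, W)}|)%N.
Proof.
rewrite card_hom dim_limg !dimvf -card_rank_mulmx; congr (_ * _)%N.
rewrite -card_hom_preim; apply: eq_card => M.
by rewrite !inE dim_limg f2mx_comp.
Qed.

Lemma card_hom_nilpotent U V (P : 'Hom(U, V)) :
  (#|[set M : finvect_type 'Hom(V, U) |
       `[< exists m, forall u, iter m ((M : 'Hom(V, U)) \o P)%VF u = 0%R >]]|
     * q ^ \dim (limg P) = #|{: finvect_type 'Hom(V, U)}|)%N.
Proof.
rewrite card_hom dim_limg !dimvf -(card_nilpotent_mulmx (f2mx P)); congr (_ * _)%N.
rewrite -card_hom_preim; apply: eq_card => M; rewrite !inE -f2mx_comp.
by apply/asboolP/idP => /iter_nilpotent_mx.
Qed.

End CountingLinearMaps.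

(** * Conditions on one coordinate of a dependent function *)

Section CoordinateChange.

Variables (I : finType) (T : I -> finType).

Definition ffwith (f : {dffun forall i, T i}) i (x : T i) : {dffun forall i, T i} :=
  [ffun j => dfwith f x j].

(* Exchanging the coordinate [f i] with a free parameter [x : T i]. *)
Lemma card_coordinate_condition i (A : pred {dffun forall i, T i})
    (B : {dffun forall i, T i} -> pred (T i)) c :
    (forall f (x : T i), A (ffwith f x) = A f) ->
    (forall f (x : T i), B (ffwith f x) = B f) ->
    (forall f, A f -> #|[set x | B f x]| = c) ->
  (#|[set f | A f && B f (f i)]| * #|T i| = #|[set f | A f]| * c)%N.
Proof.
move=> Aw Bw cardB.
have -> : (#|[set f | A f]| * c)%N = #|[set p : {dffun forall i, T i} * T i | A p.1 && B p.1 p.2]|.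
  rewrite -sum_nat_const -sum1_card (partition_big fst (mem [set f | A f])) /=; last first.
    by move=> p; rewrite !inE => /andP[].
  apply: eq_bigr => f; rewrite inE => Af; rewrite -(cardB f Af) sum1_card.
  have inj : injective (fun x : T i => (f, x)) by move=> x y [].
  rewrite -(card_imset _ inj); apply: eq_card => -[g x]; rewrite [RHS]unfold_in /= inE /=.
  apply/imsetP/andP => [[y Bfy [-> ->]]|[/andP[Ag Bgx] /eqP gf]].
    by rewrite Af eqxx; move: Bfy; rewrite inE.
  by subst g; exists x; rewrite ?inE.
have -> : (#|[set f | A f && B f (f i)]| * #|T i|)%N =
    #|setX [set f | A f && B f (f i)] [set: T i]| by rewrite cardsX cardsT.
pose swap (p : {dffun forall i, T i} * T i) := (ffwith p.1 p.2, p.1 i).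
have swapK : involutive swap.
  move=> [f x]; rewrite /swap /=; congr (_, _); last by rewrite ffunE dfwith_in.
  apply/ffunP => j; rewrite ffunE; case: dfwithP => // k ik.
  by rewrite ffunE dfwith_out.
rewrite -[LHS](card_imset _ (inv_inj swapK)); apply: eq_card => p.
rewrite inE; apply/imsetP/idP => [[[f x] + ->]|Bp].
  by rewrite !inE /= andbT Aw Bw.
exists (swap p); last by rewrite swapK.
by case: p Bp => f x /=; rewrite !inE /= andbT Aw Bw ffunE dfwith_in.
Qed.

(** Since [e > 0], the fibre size is constant on [A]; it is read off at some [f0], so an empty [A]
    is a case apart. *)
Lemma card_coordinate_condition_scaled i (A : pred {dffun forall i, T i})
    (B : {dffun forall i, T i} -> pred (T i)) c e : (0 < e)%N ->
    (forall f (x : T i), A (ffwith f x) = A f) ->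
    (forall f (x : T i), B (ffwith f x) = B f) ->
    (forall f, A f -> #|[set x | B f x]| * e = c)%N ->
  (#|[set f | A f && B f (f i)]| * #|T i| * e = #|[set f | A f]| * c)%N.
Proof.
move=> e_gt0 Aw Bw cardB; have [f0 Af0|A0] := pickP A.
  rewrite (card_coordinate_condition (c := #|[set x | B f0 x]|) Aw Bw) => [|f Af].
    by rewrite -mulnA cardB.
  by apply/eqP; rewrite -(eqn_pmul2r e_gt0) !cardB.
have -> : [set f | A f && B f (f i)] = set0 by apply/setP => f; rewrite !inE A0.
by have -> : [set f | A f] = set0; [apply/setP => f; rewrite !inE A0 | rewrite cards0 !mul0n].
Qed.

End CoordinateChange.

(** * Representations of the cyclic quiver *)

Lemma iter_predn T n (f : T -> T) x : (0 < n)%N -> iter n f x = f (iter n.-1 f x).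
Proof. by case: n. Qed.

Section CyclicQuiverCount.

Variables (F : finFieldType) (k : nat) (hk : (1 < k)%N) (V : 'I_k -> vectType F).
Local Notation q := #|F|.
Local Notation first := (first_vertex hk).
Local Notation vertex l := (iter l (@ordS k) first).

Lemma vertexE l : (l < k)%N -> vertex l = l :> nat.
Proof.
elim: l => [|l IH] // lt_lk; rewrite iterS /= IH ?modn_small //; exact: ltnW.
Qed.

Lemma vertex_val (i : 'I_k) : vertex i = i.
Proof. by apply: val_inj; rewrite /= vertexE. Qed.

Lemma vertex_last : vertex k.-1 = last_vertex hk.
Proof. by apply: val_inj; rewrite /= vertexE ?subn1 //; lia. Qed.

Lemma ordS_last : ordS (vertex k.-1) = first.
Proof. by apply: val_inj; rewrite /= vertexE ?prednK ?modnn //; lia. Qed.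

Lemma iter_to_first (i : 'I_k) : exists a, iter a (@ordS k) i = first.
Proof.
exists (k - i)%N.
have : vertex (k - i + i) = first.
  by rewrite subnK; last exact: ltnW; rewrite iter_predn ?ordS_last // ltnW.
by rewrite iterD vertex_val.
Qed.

(** All arrows together act as one self-map of the disjoint union of the spaces, so that paths can
    be cut and closed up without casts between the [V i]. *)
Definition step (f : Rep V) (p : {i : 'I_k & V i}) : {i : 'I_k & V i} :=
  Tagged (fun i => V i : Type) (arrow f (tag p) (tagged p)).

Lemma iter_step f i l (v : V i) :
  iter l (step f) (Tagged (fun i => V i : Type) v) =
  Tagged (fun i => V i : Type) (path_comp f i l v).
Proof.
elim: l => [|l IH]; first by rewrite /= id_lfunE.
by rewrite iterS IH /step /= comp_lfunE.
Qed.

Lemma iter_step0 f i l : iter l (step f) (Tagged (fun i => V i : Type) (0 : V i)) =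
  Tagged (fun i => V i : Type) (0 : V (iter l (@ordS k) i)).
Proof. by rewrite iter_step linear0. Qed.

Lemma Tagged_ecast (W : vectType F) i i' (E : i = i') (x : 'Hom(W, V i)) w :
  Tagged (fun i => V i : Type) (x w) =
  Tagged (fun i => V i : Type) ((ecast i ('Hom(W, V i)) E x) w).
Proof. by case: _ / E. Qed.

(** The cast is there because [ordS (vertex k.-1)] is only provably equal to [first]. *)
Definition close_loop (x : 'Hom(V (vertex k.-1), V (ordS (vertex k.-1)))) :
    'Hom(V (vertex k.-1), V first) :=
  ecast i ('Hom(V (vertex k.-1), V i)) ordS_last x.

Definition loop_comp (f : Rep V) : 'End(V first) :=
  (close_loop (arrow f (vertex k.-1)) \o path_comp f first k.-1)%VF.

Lemma iter_step_loop f m u : iter (m * k) (step f) (Tagged (fun i => V i : Type) (u : V first)) =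
  Tagged (fun i => V i : Type) (iter m (loop_comp f) u).
Proof.
elim: m => [|m IH] //; rewrite mulSn iterD IH (iter_predn _ _ (ltnW hk)) iter_step iterS.
by rewrite /step /= /loop_comp comp_lfunE (Tagged_ecast ordS_last).
Qed.

Lemma nilpotent_rep_loop f : nilpotent_rep f <->
  exists m, forall u, iter m (loop_comp f) u = 0.
Proof.
split=> [nilf|[m loop0] i].
  have [L zero] := nilf first; exists L => u.
  have : iter (L * k) (step f) (Tagged (fun i => V i : Type) u) =
         Tagged (fun i => V i : Type) (0 : V (vertex (L * k))).
    by rewrite iter_step zero ?lfunE //= leq_pmulr // ltnW.
  have -> : vertex (L * k) = first.
    elim: (L) => // p IHp; rewrite mulSn iterD IHp (iter_predn _ _ (ltnW hk)).
    exact: ordS_last.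
  by rewrite iter_step_loop => E; apply: (@eq_from_Tagged _ (fun i => V i : Type) first _ _ E).
(* A path from [i] takes [a] steps to reach the first vertex, and [m] rounds of the loop then kill
   it. *)
have [a ai] := iter_to_first i; exists (m * k + a)%N => l le_l.
apply/lfunP => v; rewrite lfunE /=; apply: (@eq_from_Tagged _ (fun i => V i : Type)).
have to0 p : tag p = first ->
    iter (m * k) (step f) p = Tagged (fun i => V i : Type) (0 : V first).
  case: p => i' w /= E; move: w; rewrite E => w.
  by rewrite (iter_step_loop f m w) loop0.
(* The paths of [v] and of [0] both arrive at the zero of the first space, and their remaining steps
   coincide. *)
rewrite -iter_step -(iter_step0 f) -(subnK le_l) !(iterD (l - _)) !(iterD (m * k)).
by rewrite !to0 // iter_step.
Qed.

Lemma path_comp_ffwith f j (x : finvect_type 'Hom(V j, V (ordS j))) i l :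
    (forall m, (m < l)%N -> iter m (@ordS k) i != j) ->
  path_comp (ffwith f x : Rep V) i l = path_comp f i l.
Proof.
elim: l => //= l IH out; rewrite IH => [|m lt_ml]; last exact/out/ltnW.
by congr (_ \o _)%VF; rewrite /arrow ffunE dfwith_out // eq_sym out.
Qed.

(** The length 0 is left out, its rank being the dimension of the first space. As a big conjunction
    it sheds its last condition in the induction on [l]. *)
Definition prefix_ranks (g : nat -> nat) l (f : Rep V) : bool :=
  \big[andb/true]_(m < l) (\dim (limg (path_comp f first m.+1)) == g m.+1).

Lemma prefix_ranks_ffwith g l j f (x : finvect_type 'Hom(V (vertex j), V (ordS (vertex j)))) :
  (l <= j)%N -> (j < k)%N -> prefix_ranks g l (ffwith f x) = prefix_ranks g l f.
Proof.
move=> le_lj lt_jk; apply: eq_bigr => m _; rewrite path_comp_ffwith // => p lt_pm.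
by rewrite -val_eqE /= !vertexE //; have := ltn_ord m; lia.
Qed.

Lemma prefix_ranks_last g l f : g 0%N = \dim {: V first} ->
  prefix_ranks g l f -> \dim (limg (path_comp f first l)) = g l.
Proof.
case: l => [|l] g0; first by rewrite /= lim1g.
by rewrite /prefix_ranks big_ord_recr /= => /andP[_ /eqP].
Qed.

(** Induction on [l]: the earlier conditions do not involve the arrow out of [vertex l], and the
    share of arrows giving the next rank depends only on [g l] and [g l.+1]. *)
Lemma card_prefix_ranks g l : g 0%N = \dim {: V first} -> (l < k)%N ->
  (#|[set f | prefix_ranks g l f]| *
     \prod_(m < l) q ^ (g m * \dim {: V (vertex m.+1)}) =
   #|{: Rep V}| * \prod_(m < l)
      #|[set N : 'M[F]_(g m, \dim {: V (vertex m.+1)}) | \rank N == g m.+1]|)%N.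
Proof.
move=> g0; elim: l => [|l IH] lt_lk.
  by rewrite !big_ord0 -cardsT; congr (_ * _)%N; apply: eq_card => f; rewrite !inE /prefix_ranks big_ord0.
set T := finvect_type 'Hom(V (vertex l), V (ordS (vertex l))).
set r := #|[set N : 'M[F]_(g l, \dim {: V (vertex l.+1)}) | \rank N == g l.+1]|.
set e := (q ^ (g l * \dim {: V (vertex l.+1)}))%N.
pose B (f : Rep V) (x : T) :=
  \dim (limg ((x : 'Hom(V (vertex l), V (ordS (vertex l)))) \o path_comp f first l)%VF) == g l.+1.
have q_gt0 : (0 < q)%N by apply: ltnW; apply: finRing_gt1.
have e_gt0 : (0 < e)%N by rewrite expn_gt0 q_gt0.
have T_gt0 : (0 < #|{: T}|)%N by rewrite card_hom expn_gt0 q_gt0.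
have cardB f : prefix_ranks g l f -> (#|[set x | B f x]| * e = r * #|{: T}|)%N.
  move=> /(prefix_ranks_last g0) rkl.
  have := card_hom_rank (V (ordS (vertex l))) (path_comp f first l) (g l.+1).
  by rewrite rkl.
rewrite !big_ord_recr /= -/e -/r.
have -> : #|[set f | prefix_ranks g l.+1 f]| =
    #|[set f | prefix_ranks g l f && B f (f (vertex l))]|.
  by apply: eq_card => f; rewrite !inE /prefix_ranks big_ord_recr.
have IHl := IH (ltnW lt_lk).
have cardS : (#|[set f | prefix_ranks g l f && B f (f (vertex l))]| * #|{: T}| * e =
    #|[set f | prefix_ranks g l f]| * (r * #|{: T}|))%N.
  apply: card_coordinate_condition_scaled cardB => // f x.
    by rewrite prefix_ranks_ffwith // ltnW.
  by rewrite /B path_comp_ffwith // => p lt_pl; rewrite -val_eqE /= !vertexE //; lia.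
apply/eqP; rewrite -(eqn_pmul2r T_gt0); apply/eqP.
rewrite [in RHS]mulnA -IHl; set p := (\prod_(m < l) _)%N.
have := congr1 (muln^~ p) cardS => /= eqp; apply: etrans (etrans eqp _); ring.
Qed.

(** With both endpoints variable, the cast along [E] can be eliminated. *)
Lemma card_close_nilpotent (W : vectType F) i i' (E : i = i') (P : 'Hom(V i', W)) :
  (#|[set x : finvect_type 'Hom(W, V i) | `[< exists m, forall u,
       iter m (ecast i ('Hom(W, V i)) E (x : 'Hom(W, V i)) \o P)%VF u = 0%R >]]|
     * q ^ \dim (limg P) = #|{: finvect_type 'Hom(W, V i)}|)%N.
Proof. by case: i' / E P => P; apply: card_hom_nilpotent. Qed.

(** The last arrow enters none of the rank conditions, and nilpotency is a condition on it through
    the loop, met with probability [q ^ - g k.-1]. *)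
Lemma card_nilpotent_prefix_ranks g : g 0%N = \dim {: V first} ->
  (#|[set f | prefix_ranks g k.-1 f && `[< nilpotent_rep f >]]| * q ^ g k.-1 =
   #|[set f | prefix_ranks g k.-1 f]|)%N.
Proof.
move=> g0; set T := finvect_type 'Hom(V (vertex k.-1), V (ordS (vertex k.-1))).
pose B (f : Rep V) (x : T) := `[< exists m, forall u,
  iter m (close_loop x \o path_comp f first k.-1)%VF u = 0%R >].
have q_gt0 : (0 < q)%N by apply: ltnW; apply: finRing_gt1.
have T_gt0 : (0 < #|{: T}|)%N by rewrite card_hom expn_gt0 q_gt0.
have lt_k : (k.-1 < k)%N by lia.
have cardB f : prefix_ranks g k.-1 f -> (#|[set x | B f x]| * q ^ g k.-1 = #|{: T}|)%N.
  by move=> /(prefix_ranks_last g0) <-; apply: card_close_nilpotent.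
have -> : [set f | prefix_ranks g k.-1 f && `[< nilpotent_rep f >]] =
    [set f | prefix_ranks g k.-1 f && B f (f (vertex k.-1))].
  apply/setP => f; rewrite !inE; congr (_ && _).
  by apply: asbool_equiv_eq; apply: nilpotent_rep_loop.
apply/eqP; rewrite -(eqn_pmul2r T_gt0) mulnAC; apply/eqP.
apply: card_coordinate_condition_scaled cardB => [|f x|f x].
- by rewrite expn_gt0 q_gt0.
- by rewrite prefix_ranks_ffwith.
by rewrite /B path_comp_ffwith // => p lt_pl; rewrite -val_eqE /= !vertexE //; lia.
Qed.

End CyclicQuiverCount.

(** * Rational form of the counts *)

Section RationalForm.

Variable F : finFieldType.
Local Notation q := #|F|.
Local Notation Q := (q%:R : rat).

Lemma cardF_gt1 : 1 < Q.
Proof. by rewrite ltr1n finRing_gt1. Qed.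

Lemma cardF_neq0 : Q != 0.
Proof. by rewrite gt_eqF // (lt_trans ltr01 cardF_gt1). Qed.

Lemma one_sub_exp_neq0 n : (0 < n)%N -> 1 - Q ^+ n != 0.
Proof.
move=> n_gt0; by rewrite subr_eq0 eq_sym gt_eqF // exprn_egt1 ?cardF_gt1 // -lt0n.
Qed.

Lemma qbinom_id n : qbinom Q n n = 1.
Proof.
rewrite /qbinom (reindex_inj rev_ord_inj) /=.
under eq_bigr => i _ do rewrite subKn //.
by rewrite divff // prodf_seq_neq0; apply/allP => i _; rewrite one_sub_exp_neq0.
Qed.

Lemma card_row_free_rat s n :
  (#|[set B : 'M[F]_(s, n) | row_free B]|%:R : rat) = \prod_(i < s) (Q ^+ n - Q ^+ i).
Proof.
rewrite card_row_free natr_prod; have [le_sn|lt_ns] := leqP s n.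
  apply: eq_bigr => i _; rewrite natrB ?natrX // leq_exp2l ?finRing_gt1 //.
  exact: leq_trans (ltnW (ltn_ord i)) le_sn.
(* The factor at [i = n] is zero on both sides, so truncated subtraction does no harm. *)
by rewrite (bigD1 (Ordinal lt_ns)) //= [RHS](bigD1 (Ordinal lt_ns)) //= subnn subrr !mul0r.
Qed.

(** An independent family amounts to a subspace of dimension [s] with a basis. The proof compares
    products, taking [- q ^ i] out of each [q ^ n - q ^ i] and each [q ^ s - q ^ i]. *)
Lemma card_row_free_qbinom s n :
  (#|[set B : 'M[F]_(s, n) | row_free B]|%:R : rat) = qbinom Q n s * (GL_order F s)%:R.
Proof.
rewrite GL_order_row_free !card_row_free_rat /qbinom.
have [le_sn|lt_ns] := leqP s n; last first.
  rewrite (bigD1 (Ordinal lt_ns)) //= [in RHS](bigD1 (Ordinal lt_ns)) //=.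
  by rewrite subnn expr0 !subrr !mul0r.
rewrite mulrAC.
have -> : \prod_(i < s) (Q ^+ s - Q ^+ i) =
    \prod_(i < s) (- Q ^+ i) * \prod_(i < s) (1 - Q ^+ i.+1).
  rewrite [X in _ * X](reindex_inj rev_ord_inj) /= -big_split /=.
  apply: eq_bigr => i _; rewrite mulrBr mulr1 mulNr -exprD opprK addrC.
  by rewrite -subSn // subSS subnKC // ltnW.
rewrite mulrA mulfK; last by rewrite prodf_seq_neq0; apply/allP => i _; rewrite one_sub_exp_neq0.
rewrite -big_split; apply: eq_bigr => i _ /=; rewrite mulrC mulrBr mulr1 mulNr -exprD opprK addrC.
by rewrite subnKC // (leq_trans (ltnW (ltn_ord i))).
Qed.

Lemma card_rank_qbinom r n s :
  (#|[set N : 'M[F]_(r, n) | \rank N == s]|%:R : rat) =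
    qbinom Q r s * qbinom Q n s * (GL_order F s)%:R.
Proof.
have GLnz : (GL_order F s)%:R != 0 :> rat.
  rewrite GL_order_row_free pnatr_eq0 -lt0n; apply/card_gt0P.
  by exists 1%:M; rewrite inE /row_free mxrank1.
apply: (mulIf GLnz); rewrite -natrM card_rank_GL_order natrM !card_row_free_qbinom; ring.
Qed.

End RationalForm.

Theorem theorem3p9 (F : finFieldType) (k : nat) (hk : (1 < k)%N)
    (beta : {ffun 'I_k -> nat}) (V : 'I_k -> vectType F)
    (hV : forall i : 'I_k, \dim {: V i} = beta i)
    (gamma : {ffun 'I_k -> nat}) (hgamma : is_rank_vector V hk gamma) :
  let q : rat := #|F|%:R in
  (#|nilpotent_of_rank V hk gamma|%:R : rat) =
    q ^ count_exponent hk beta gamma * qbinom_vector q beta gamma *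
    \prod_(i < k | (i.+1 < k)%N)
       (qbinom q (gamma i) (gamma (ordS i)) * (GL_order F (gamma (ordS i)))%:R).
Proof.
move=> q; have q_neq0 : q != 0 by apply: cardF_neq0.
pose v l := iter l (@ordS k) (first_vertex hk); pose g l := gamma (v l).
have g0 : gamma (first_vertex hk) = beta (first_vertex hk).
  by have [f <-] := hgamma; rewrite rank_vector_first hV.
have reindex (G : 'I_k -> rat) : \prod_(m < k.-1) G (v m) = \prod_(i < k | (i.+1 < k)%N) G i.
  transitivity (\prod_(0 <= m < k.-1) G (v m)); first by rewrite big_mkord.
  rewrite (big_nat_widen _ _ k) ?leq_pred // big_mkord; apply: eq_big => i.
    by rewrite /=; lia.
  by rewrite /v vertex_val.
have split_last (G : 'I_k -> rat) :
    \prod_i G i = G (last_vertex hk) * \prod_(i < k | (i.+1 < k)%N) G i.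
  rewrite (bigD1 (last_vertex hk)) //=; congr (_ * _); apply: eq_bigl => i.
  by rewrite -val_eqE /=; have := ltn_ord i; lia.
have ordS_last_vertex : ordS (last_vertex hk) = first_vertex hk.
  by rewrite -vertex_last ordS_last.
have dimg0 : g 0%N = \dim {: V (first_vertex hk)} by rewrite hV.
have -> : nilpotent_of_rank V hk gamma =
    [set f | prefix_ranks hk g k.-1 f & `[< nilpotent_rep f >]].
  apply/setP => f; rewrite !inE andbC; congr (_ && _).
  rewrite /prefix_ranks big_andE; apply/eqP/forallP => [rkf m|ranks].
    by rewrite /g -rkf ffunE vertexE //; have := ltn_ord m; lia.
  apply/ffunP => j; rewrite ffunE -[in RHS](vertex_val hk j) -/(v j) -/(g j).
  (* At the first vertex, which [prefix_ranks] omits, both entries are the dimension of the first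
     space. *)
  case: j => -[|m] lt_mk /=; first by rewrite dimg0 lim1g.
  by apply/eqP; apply: (ranks (Ordinal (_ : m < k.-1)%N)); lia.
have counted := card_prefix_ranks dimg0 (ltac:(lia) : k.-1 < k)%N.
have := card_nilpotent_prefix_ranks dimg0.
set N := #|_|; move=> cN; move: counted; rewrite -cN => /(congr1 (fun n : nat => n%:R : rat)).
rewrite !natrM !natr_prod natrX.
have -> : (#|{: Rep V}|%:R : rat) = \prod_(i < k) q ^ ((beta i)%:Z * (beta (ordS i))%:Z).
  rewrite card_dep_ffun foldrE big_map big_enum natr_prod /=.
  by apply: eq_bigr => i _; rewrite card_hom !hV natrX.
have -> : g k.-1 = gamma (last_vertex hk) by rewrite /g /v vertex_last.
rewrite -/q; set l := last_vertex hk.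
have -> : \prod_(m < k.-1) (#|F| ^ (g m * \dim {: V (v m.+1)}))%:R =
    \prod_(i < k | (i.+1 < k)%N) q ^ ((gamma i)%:Z * (beta (ordS i))%:Z).
  by rewrite -reindex; apply: eq_bigr => m _; rewrite hV natrX.
have -> : \prod_(m < k.-1) #|[set M : 'M[F]_(g m, \dim {: V (v m.+1)}) | \rank M == g m.+1]|%:R =
    \prod_(i < k | (i.+1 < k)%N) (qbinom q (gamma i) (gamma (ordS i)) *
      qbinom q (beta (ordS i)) (gamma (ordS i)) * (GL_order F (gamma (ordS i)))%:R).
  by rewrite -reindex; apply: eq_bigr => m _; rewrite card_rank_qbinom hV.
set gA := \prod_(i < k | _) q ^ _; set Bq := \prod_(i < k) q ^ _.
(* In the dot product the last vertex contributes the exponent [- gamma_k beta_1], absent from [gA];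
   the term [gamma_k (beta_1 - 1)] turns it into [- gamma_k], the nilpotency factor. *)
have expE : q ^ count_exponent hk beta gamma * (q ^+ gamma l * gA) = Bq.
  rewrite /count_exponent -/l expfzDr // mulrBr mulr1 expfzDr //.
  have -> : q ^ dot (fun i => (beta i)%:Z - (gamma i)%:Z) (shift (fun i => (beta i)%:Z)) =
      \prod_i q ^ (((beta i)%:Z - (gamma i)%:Z) * (beta (ordS i))%:Z).
    by rewrite /dot (big_morph (fun z => q ^ z) (fun x y => expfzDr x y q_neq0) (expr0z q)).
  have -> : Bq = \prod_i q ^ (((beta i)%:Z - (gamma i)%:Z) * (beta (ordS i))%:Z) *
      \prod_i q ^ ((gamma i)%:Z * (beta (ordS i))%:Z).
    by rewrite -big_split; apply: eq_bigr => i _ /=; rewrite -expfzDr // -mulrDl subrK.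
  rewrite [X in _ = _ * X]split_last -/l -/gA ordS_last_vertex -mulrA; congr (_ * _).
  have -> : q ^+ gamma l = q ^ (gamma l)%:Z by [].
  by rewrite mulrA -!expfzDr // subrK.
(* The rank counts give the factors at all vertices but the first, where [gamma] and [beta] agree
   and the factor is 1. *)
have qbinomE : qbinom_vector q beta gamma =
    \prod_(i < k | (i.+1 < k)%N) qbinom q (beta (ordS i)) (gamma (ordS i)).
  rewrite /qbinom_vector (reindex_inj (@ordS_inj k)) split_last ordS_last_vertex g0.
  by rewrite qbinom_id mul1r.
have nz : q ^+ gamma l * gA != 0.
  rewrite mulf_neq0 ?expf_neq0 // prodf_seq_neq0; apply/allP => i _.
  by rewrite expfz_neq0 ?implybT.
move=> eqN; apply: (mulIf nz); rewrite mulrA eqN -expE qbinomE !big_split /=; ring.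
Qed.
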